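(* Let $A,B,C$ and $K_1,K_2,K_3$ be smooth functions of $(x,y,z)$ on an open subset of $\mathbb{R}^3$, with $A,B,C$, $\partial A/\partial y$ and $\partial A/\partial z$ nowhere zero. Suppose that $K_1,K_2,K_3$ satisfy the system for the principal curvatures of three-dimensional normal spaces $$(K_2-K_3)\frac{\partial K_1}{\partial x}+3(K_3-K_1)\frac{\partial K_2}{\partial x}+3(K_1-K_2)\frac{\partial K_3}{\partial x}=0,$$ $$3(K_2-K_3)\frac{\partial K_1}{\partial y}+(K_3-K_1)\frac{\partial K_2}{\partial y}+3(K_1-K_2)\frac{\partial K_3}{\partial y}=0,$$ $$3(K_2-K_3)\frac{\partial K_1}{\partial z}+3(K_3-K_1)\frac{\partial K_2}{\partial z}+(K_1-K_2)\frac{\partial K_3}{\partial z}=0,$$ and that the following relations hold (subscripts $x,y,z$ denote partial derivatives): $$\frac{\partial K_1}{\partial y}=\frac{A_y}{A}(K_2-K_1),\qquad \frac{\partial K_1}{\partial z}=\frac{A_z}{A}(K_3-K_1),$$ $$\frac{\partial K_2}{\partial x}=\frac{B_x}{B}(K_1-K_2),\qquad \frac{\partial K_2}{\partial z}=\frac{B_z}{B}(K_3-K_2),$$ $$\frac{\partial K_3}{\partial x}=\frac{C_x}{C}(K_1-K_3),\qquad \frac{\partial K_3}{\partial y}=\frac{C_y}{C}(K_2-K_3).$$ Then $K_1$ satisfies the system of linear equations $$\frac{\partial^2K_1}{\partial x\partial y}+\frac{A_y}{A}\frac{\partial K_1}{\partial x}+\left(\frac{A_x}{A}+\frac{B_x}{B}-\frac{A_{xy}}{A_y}\right)\frac{\partial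 K_1}{\partial y}=0,$$ $$\frac{\partial^2K_1}{\partial x\partial z}+\frac{A_z}{A}\frac{\partial K_1}{\partial x}+\left(\frac{C_x}{C}+\frac{A_x}{A}-\frac{A_{xz}}{A_z}\right)\frac{\partial K_1}{\partial z}=0,$$ $$\frac{\partial^2K_1}{\partial y\partial z}+\left(\frac{B_z}{B}+\frac{A_z}{A}-\frac{A_{yz}}{A_y}\right)\frac{\partial K_1}{\partial y}+\left(-\frac{A_y\,B_z}{A_z\,B}+\frac{A_y}{A}\right)\frac{\partial K_1}{\partial z}=0.$$
   Context: The functions $A,B,C$ are the components of a diagonal metric $ds^2=A^2dx^2+B^2dy^2+C^2dz^2$. An $n$-dimensional Riemannian space with metric $g_{ij}dx^idx^j$ is called normal if its principal curvatures $K_i$ (the roots $\kappa$ of $\det(b_{ij}-\kappa g_{ij})=0$ for a given second-rank tensor $b_{ij}$) satisfy, for some functions $\lambda_l,\mu_l$ of the coordinates, $\partial K_l/\partial x^l=3\lambda_l+3\mu_lK_l$, and for $i\neq l$: $\partial K_i/\partial x^l=\lambda_l+\mu_lK_i$ and $\partial \ln g_{ii}/\partial x^l=\frac{2}{K_l-K_i}\,\partial K_i/\partial x^l$. This is background only; the claim is formulated entirely in terms of the functions $A,B,C,K_1,K_2,K_3$. *)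

(* Defs.v *)
From Stdlib Require Import Reals.
From Coquelicot Require Import Coquelicot.
Open Scope R_scope.

(* Coquelicot equips this product with the product (sup) uniform structure,
   so [open] and [continuous] below refer to the usual topology of R^3. *)
Definition R3 : Type := (R * R * R)%type.

(* Functions on an open set U are represented by total functions R3 -> R whose
   values outside U are irrelevant: at a point of the open set U, continuity
   and partial derivatives depend only on the values taken on U.  [Derive] is
   total; it is the partial derivative wherever [smooth_on] holds. *)
Definition dx (f : R3 -> R) : R3 -> R :=
  fun '(x, y, z) => Derive (fun t => f (t, y, z)) x.
Definition dy (f : R3 -> R) : R3 -> R :=
  fun '(x, y, z) => Derive (fun t => f (x, t, z)) y.
Definition dz (f : R3 -> R) : R3 -> R :=
  fun '(x, y, z) => Derive (fun t => f (x, y, t)) z.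

Definition has_partials (f : R3 -> R) : R3 -> Prop :=
  fun '(x, y, z) =>
    ex_derive (fun t => f (t, y, z)) x /\
    ex_derive (fun t => f (x, t, z)) y /\
    ex_derive (fun t => f (x, y, t)) z.

(* Class C^k on U: all iterated partial derivatives of order at most k exist
   and are continuous on U. *)
Fixpoint Ck_on (k : nat) (U : R3 -> Prop) (f : R3 -> R) : Prop :=
  (forall p, U p -> continuous f p) /\
  match k with
  | O => True
  | S k' =>
      (forall p, U p -> has_partials f p) /\
      Ck_on k' U (dx f) /\ Ck_on k' U (dy f) /\ Ck_on k' U (dz f)
  end.

Definition smooth_on (U : R3 -> Prop) (f : R3 -> R) : Prop :=
  forall k : nat, Ck_on k U f.

(* Main.v *)
(* Differentiate the relation for K1_y in x and in z and the relation for K1_z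
   in x, then eliminate the first derivatives of K2 and K3 with the remaining
   relations; with the symmetry of second derivatives each equation becomes an
   identity of rational functions.  The third equation must be obtained from
   K1_y, whose z-derivative produces B_z, rather than from K1_z, whose
   y-derivative would produce C_y. *)

Require Import Defs.
From Stdlib Require Import Reals.
From Coquelicot Require Import Coquelicot.
Open Scope R_scope.

(** Balls of a product are products of balls, so the two eventual conditions combine by intersecting
    neighbourhoods. *)
Lemma continuous_pair {T V W : UniformSpace} (f : T -> V) (g : T -> W) (t : T) :
  continuous f t -> continuous g t -> continuous (fun s => (f s, g s)) t.
Proof.
  intros hf hg; apply filterlim_locally; intros eps.
  generalize (filter_and _ _ (proj1 (filterlim_locally f (f t)) hf eps)
                             (proj1 (filterlim_locally g (g t)) hg eps)).
  now apply filter_imp.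
Qed.

(** Embeddings of coordinate planes, here and in the next two lemmas, transfer topological facts on
    [R3] to functions of two real variables, the setting of [Schwarz]. *)
Lemma continuous_slice_xy (z : R) (q : R * R) :
  continuous (fun q : R * R => ((fst q, snd q, z) : R3)) q.
Proof.
  apply (continuous_pair (fun q : R * R => (fst q, snd q)) (fun _ => z)).
  - apply (continuous_pair fst snd); [destruct q; apply continuous_fst | destruct q; apply continuous_snd].
  - apply continuous_const.
Qed.

Lemma continuous_slice_xz (y : R) (q : R * R) :
  continuous (fun q : R * R => ((fst q, y, snd q) : R3)) q.
Proof.
  apply (continuous_pair (fun q : R * R => (fst q, y)) snd).
  - apply (continuous_pair fst (fun _ => y)); [destruct q; apply continuous_fst | apply continuous_const].
  - destruct q; apply continuous_snd.
Qed.

Lemma continuous_slice_yz (x : R) (q : R * R) :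
  continuous (fun q : R * R => ((x, fst q, snd q) : R3)) q.
Proof.
  apply (continuous_pair (fun q : R * R => (x, fst q)) snd).
  - apply (continuous_pair (fun _ => x) fst); [apply continuous_const | destruct q; apply continuous_fst].
  - destruct q; apply continuous_snd.
Qed.

(** An open set is a neighbourhood of each of its points, and continuity of [e] pulls it back to a
    planar neighbourhood. *)
Lemma open_slice_2d (e : R * R -> R3) (U : R3 -> Prop) (u v : R) :
  open U -> continuous e (u, v) -> U (e (u, v)) ->
  locally_2d (fun a b => U (e (a, b))) u v.
Proof.
  intros hU he Hp.
  apply locally_2d_locally.
  apply (filter_imp (fun q => U (e q))); [now intros [a b] |].
  apply he, (hU _ Hp).
Qed.

Lemma continuous_slice_2d (e : R * R -> R3) (f : R3 -> R) (u v : R) :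
  continuous e (u, v) -> continuous f (e (u, v)) ->
  continuity_2d_pt (fun a b => f (e (a, b))) u v.
Proof.
  intros he hf.
  apply continuity_2d_pt_filterlim.
  apply (filterlim_ext (fun q => f (e q))); [now intros [a b] |].
  exact (continuous_comp e f (u, v) he hf).
Qed.

(** The common shape of the relations for the curvatures, with [g / h] a logarithmic derivative.
    Equality near [t] is enough because a derivative is local; the rest is the product and quotient
    rules. *)
Lemma Derive_quot_mult_minus (f g h k l : R -> R) (t : R) :
  locally t (fun s => f s = g s / h s * (k s - l s)) ->
  ex_derive g t -> ex_derive h t -> ex_derive k t -> ex_derive l t -> h t <> 0 ->
  Derive f t = (Derive g t * h t - g t * Derive h t) / h t ^ 2 * (k t - l t)
               + g t / h t * (Derive k t - Derive l t).
Proof.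
  intros Hf Hg Hh Hk Hl H0.
  rewrite (Derive_ext_loc _ _ _ Hf), Derive_mult, Derive_div, Derive_minus; trivial.
  - now apply ex_derive_div.
  - now apply (ex_derive_minus k l).
Qed.

Section Smooth.

Context (U : R3 -> Prop) (hU : open U).

(** Restricting a planar neighbourhood to a line allows a relation known only on [U] to be
    differentiated along that line. *)
Lemma locally_x (x y z : R) : U (x, y, z) -> locally x (fun t => U (t, y, z)).
Proof.
  intros Hp.
  apply (locally_2d_1d_const_y (fun a b => U (a, b, z))).
  exact (open_slice_2d _ _ _ _ hU (continuous_slice_xy z (x, y)) Hp).
Qed.

Lemma locally_z (x y z : R) : U (x, y, z) -> locally z (fun t => U (x, y, t)).
Proof.
  intros Hp.
  apply (locally_2d_1d_const_x (fun a b => U (a, y, b))).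
  exact (open_slice_2d _ _ _ _ hU (continuous_slice_xz y (x, z)) Hp).
Qed.

(** Order [k] for the derivative is a conjunct of order [S k] for [f]. *)
Lemma smooth_on_dx (f : R3 -> R) : smooth_on U f -> smooth_on U (dx f).
Proof. intros hf k; apply (hf (S k)). Qed.

Lemma smooth_on_dy (f : R3 -> R) : smooth_on U f -> smooth_on U (dy f).
Proof. intros hf k; apply (hf (S k)). Qed.

Lemma smooth_on_dz (f : R3 -> R) : smooth_on U f -> smooth_on U (dz f).
Proof. intros hf k; apply (hf (S k)). Qed.

Lemma smooth_on_continuous (f : R3 -> R) (p : R3) :
  smooth_on U f -> U p -> continuous f p.
Proof. intros hf; apply (hf O). Qed.

Lemma smooth_on_partials (f : R3 -> R) (p : R3) :
  smooth_on U f -> U p -> has_partials f p.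
Proof. intros hf; apply (hf 1%nat). Qed.

Lemma dx_dy_comm (f : R3 -> R) (p : R3) :
  smooth_on U f -> U p -> dx (dy f) p = dy (dx f) p.
Proof.
  destruct p as [[x y] z]; intros hf Hp.
  pose proof (continuous_slice_xy z (x, y)) as he.
  (* Both mixed partials are, by conversion, nested derivatives of this slice. What remains is
     existence of the partials near the point, where openness of [U] enters, and continuity of the
     two mixed partials at the point. *)
  apply (Schwarz (fun a b => f (a, b, z))).
  - generalize (open_slice_2d _ _ _ _ hU he Hp).
    apply locally_2d_impl, locally_2d_forall; cbn; intros a b H.
    destruct (smooth_on_partials f _ hf H) as (H1 & H2 & _).
    destruct (smooth_on_partials _ _ (smooth_on_dy f hf) H) as (H3 & _).
    destruct (smooth_on_partials _ _ (smooth_on_dx f hf) H) as (_ & H4 & _).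
    auto.
  - apply (continuous_slice_2d _ (dx (dy f)) x y he), smooth_on_continuous; trivial.
    now apply smooth_on_dx, smooth_on_dy.
  - apply (continuous_slice_2d _ (dy (dx f)) x y he), smooth_on_continuous; trivial.
    now apply smooth_on_dy, smooth_on_dx.
Qed.

Lemma dx_dz_comm (f : R3 -> R) (p : R3) :
  smooth_on U f -> U p -> dx (dz f) p = dz (dx f) p.
Proof.
  destruct p as [[x y] z]; intros hf Hp.
  pose proof (continuous_slice_xz y (x, z)) as he.
  apply (Schwarz (fun a b => f (a, y, b))).
  - generalize (open_slice_2d _ _ _ _ hU he Hp).
    apply locally_2d_impl, locally_2d_forall; cbn; intros a b H.
    destruct (smooth_on_partials f _ hf H) as (H1 & _ & H2).
    destruct (smooth_on_partials _ _ (smooth_on_dz f hf) H) as (H3 & _).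
    destruct (smooth_on_partials _ _ (smooth_on_dx f hf) H) as (_ & _ & H4).
    auto.
  - apply (continuous_slice_2d _ (dx (dz f)) x z he), smooth_on_continuous; trivial.
    now apply smooth_on_dx, smooth_on_dz.
  - apply (continuous_slice_2d _ (dz (dx f)) x z he), smooth_on_continuous; trivial.
    now apply smooth_on_dz, smooth_on_dx.
Qed.

Lemma dy_dz_comm (f : R3 -> R) (p : R3) :
  smooth_on U f -> U p -> dy (dz f) p = dz (dy f) p.
Proof.
  destruct p as [[x y] z]; intros hf Hp.
  pose proof (continuous_slice_yz x (y, z)) as he.
  apply (Schwarz (fun a b => f (x, a, b))).
  - generalize (open_slice_2d _ _ _ _ hU he Hp).
    apply locally_2d_impl, locally_2d_forall; cbn; intros a b H.
    destruct (smooth_on_partials f _ hf H) as (_ & H1 & H2).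
    destruct (smooth_on_partials _ _ (smooth_on_dz f hf) H) as (_ & H3 & _).
    destruct (smooth_on_partials _ _ (smooth_on_dy f hf) H) as (_ & _ & H4).
    auto.
  - apply (continuous_slice_2d _ (dy (dz f)) y z he), smooth_on_continuous; trivial.
    now apply smooth_on_dy, smooth_on_dz.
  - apply (continuous_slice_2d _ (dz (dy f)) y z he), smooth_on_continuous; trivial.
    now apply smooth_on_dz, smooth_on_dy.
Qed.

(** The form used to differentiate the relations for [dy K1] and [dz K1] in [x]: [g] is then a first
    partial of [A], and [h] is [A]. *)
Lemma dx_quot_mult_minus (f g h k l : R3 -> R) (p : R3) :
  (forall q, U q -> f q = g q / h q * (k q - l q)) ->
  smooth_on U g -> smooth_on U h -> smooth_on U k -> smooth_on U l ->
  U p -> h p <> 0 ->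
  dx f p = (dx g p * h p - g p * dx h p) / h p ^ 2 * (k p - l p)
           + g p / h p * (dx k p - dx l p).
Proof.
  destruct p as [[x y] z]; intros Hf Hg Hh Hk Hl Hp H0.
  apply (Derive_quot_mult_minus (fun t => f (t, y, z)) (fun t => g (t, y, z))
           (fun t => h (t, y, z)) (fun t => k (t, y, z)) (fun t => l (t, y, z)));
    [| now apply (smooth_on_partials _ (x, y, z)) .. | exact H0].
  generalize (locally_x x y z Hp).
  apply filter_imp; intros t; apply Hf.
Qed.

Lemma dz_quot_mult_minus (f g h k l : R3 -> R) (p : R3) :
  (forall q, U q -> f q = g q / h q * (k q - l q)) ->
  smooth_on U g -> smooth_on U h -> smooth_on U k -> smooth_on U l ->
  U p -> h p <> 0 ->
  dz f p = (dz g p * h p - g p * dz h p) / h p ^ 2 * (k p - l p)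
           + g p / h p * (dz k p - dz l p).
Proof.
  destruct p as [[x y] z]; intros Hf Hg Hh Hk Hl Hp H0.
  apply (Derive_quot_mult_minus (fun t => f (x, y, t)) (fun t => g (x, y, t))
           (fun t => h (x, y, t)) (fun t => k (x, y, t)) (fun t => l (x, y, t)));
    [| now apply (smooth_on_partials _ (x, y, z)) .. | exact H0].
  generalize (locally_z x y z Hp).
  apply filter_imp; intros t; apply Hf.
Qed.

End Smooth.

(* Mixed partials are read literally: a subscript A_xy is dy (dx A), and
   d^2 K / dx dy is dx (dy K). *)
Theorem theorem3
  (U : R3 -> Prop) (A B C K1 K2 K3 : R3 -> R)
  (hU : open U)
  (hA : smooth_on U A) (hB : smooth_on U B) (hC : smooth_on U C)
  (hK1 : smooth_on U K1) (hK2 : smooth_on U K2) (hK3 : smooth_on U K3)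
  (hA0 : forall p, U p -> A p <> 0)
  (hB0 : forall p, U p -> B p <> 0)
  (hC0 : forall p, U p -> C p <> 0)
  (hAy0 : forall p, U p -> dy A p <> 0)
  (hAz0 : forall p, U p -> dz A p <> 0)
  (hx : forall p, U p ->
     (K2 p - K3 p) * dx K1 p + 3 * (K3 p - K1 p) * dx K2 p
       + 3 * (K1 p - K2 p) * dx K3 p = 0)
  (hy : forall p, U p ->
     3 * (K2 p - K3 p) * dy K1 p + (K3 p - K1 p) * dy K2 p
       + 3 * (K1 p - K2 p) * dy K3 p = 0)
  (hz : forall p, U p ->
     3 * (K2 p - K3 p) * dz K1 p + 3 * (K3 p - K1 p) * dz K2 p
       + (K1 p - K2 p) * dz K3 p = 0)
  (hK1y : forall p, U p -> dy K1 p = dy A p / A p * (K2 p - K1 p))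
  (hK1z : forall p, U p -> dz K1 p = dz A p / A p * (K3 p - K1 p))
  (hK2x : forall p, U p -> dx K2 p = dx B p / B p * (K1 p - K2 p))
  (hK2z : forall p, U p -> dz K2 p = dz B p / B p * (K3 p - K2 p))
  (hK3x : forall p, U p -> dx K3 p = dx C p / C p * (K1 p - K3 p))
  (hK3y : forall p, U p -> dy K3 p = dy C p / C p * (K2 p - K3 p)) :
  (forall p, U p ->
     dx (dy K1) p + dy A p / A p * dx K1 p
       + (dx A p / A p + dx B p / B p - dy (dx A) p / dy A p) * dy K1 p = 0) /\
  (forall p, U p ->
     dx (dz K1) p + dz A p / A p * dx K1 p
       + (dx C p / C p + dx A p / A p - dz (dx A) p / dz A p) * dz K1 p = 0) /\
  (forall p, U p ->
     dy (dz K1) p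
       + (dz B p / B p + dz A p / A p - dz (dy A) p / dy A p) * dy K1 p
       + (- (dy A p * dz B p) / (dz A p * B p) + dy A p / A p) * dz K1 p = 0).
Proof.
  repeat split; intros p Hp;
    pose proof (hA0 p Hp); pose proof (hB0 p Hp); pose proof (hC0 p Hp);
    pose proof (hAy0 p Hp); pose proof (hAz0 p Hp).
  (* The product rule yields [- dy A p / A p * dx K1 p], which cancels the second term of the
     equation; by [hK2x] all the rest is a multiple of [K2 p - K1 p] with coefficient zero. *)
  - rewrite (dx_quot_mult_minus U hU _ _ _ _ _ p hK1y)
      by (trivial; now apply smooth_on_dy).
    rewrite (dx_dy_comm U hU A) by trivial.
    rewrite hK1y, hK2x by trivial.
    field; auto.
  (* The same cancellation with [z], [C], [K3] in place of [y], [B], [K2]. *)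
  - rewrite (dx_quot_mult_minus U hU _ _ _ _ _ p hK1z)
      by (trivial; now apply smooth_on_dz).
    rewrite (dx_dz_comm U hU A) by trivial.
    rewrite hK1z, hK3x by trivial.
    field; auto.
  (* Symmetry is applied to [K1] itself, so that the relation for [dy K1] is the one differentiated.
     The terms in [dz B] then cancel because [K3 - K2 = (K3 - K1) - (K2 - K1)]. *)
  - rewrite (dy_dz_comm U hU K1) by trivial.
    rewrite (dz_quot_mult_minus U hU _ _ _ _ _ p hK1y)
      by (trivial; now apply smooth_on_dy).
    rewrite hK1y, hK1z, hK2z by trivial.
    field; auto.
Qed.
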